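(* For $n\in\mathbb{N}$ let $S_n=\{y\in[0,\tfrac23]:|L(y)|=n\}$, and let $\lambda$ denote Lebesgue measure. (i) For each $k\ge3$, $\lambda(S_2\cap I_k)>0$. (ii) For each $m\in\mathbb{N}$, $\lambda(S_{2^m})>0$. (iii) If $\lambda(S_n\cap I_3)>0$ for some $n\in\mathbb{N}$, then $\lambda(S_{2^mn})>0$ for every $m\in\mathbb{N}$.
   Context: Let $\phi(x)=\operatorname{dist}(x,\mathbb{Z})$; the Takagi function is $T(x)=\sum_{n=0}^\infty 2^{-n}\phi(2^nx)$, and $L(y)=\{x\in[0,1]:T(x)=y\}$. $|\cdot|$ denotes cardinality. $\mathbb{N}=\{1,2,3,\dots\}$. Let $t_k=k/2^k$ for $k\in\mathbb{N}$, and $I_k=[t_k,t_{k-1})$ for $k\ge3$; in particular $I_3=[\frac38,\frac12)$. *)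

(* Defs.v *)
From mathcomp Require Import all_boot all_order all_algebra.
From mathcomp Require Import all_classical all_reals all_analysis.

Set Implicit Arguments.
Unset Strict Implicit.
Unset Printing Implicit Defensive.

Import Order.TTheory GRing.Theory Num.Theory.
Import numFieldNormedType.Exports.

Local Open Scope classical_set_scope.
Local Open Scope card_scope.
Local Open Scope ring_scope.

Definition dist_int (R : realType) (x : R) : R :=
  inf [set `|x - z%:~R| | z in [set: int]].

Definition takagi (R : realType) (x : R) : R :=
  limn (series (fun n : nat => 2 ^- n * dist_int (2 ^+ n * x))).

Definition level_set (R : realType) (y : R) : set R :=
  [set x | x \in `[0, 1] /\ takagi x = y].

Definition level_card (R : realType) (n : nat) : set R :=
  [set y | y \in `[0, 2 / 3] /\ level_set y #= `I_n].
Arguments level_card R n : clear implicits.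

Definition takagi_pt (R : realType) (k : nat) : R := k%:R / 2 ^+ k.
Arguments takagi_pt R k : clear implicits.

(* Meaningful for [3 <= k], where [takagi_pt] is decreasing. *)
Definition takagi_itv (R : realType) (k : nat) : set R :=
  `[takagi_pt R k, takagi_pt R k.-1[%classic.
Arguments takagi_itv R k : clear implicits.

(* Main.v *)
Require Import Defs.
From mathcomp Require Import all_boot all_order all_algebra.
From mathcomp Require Import all_classical all_reals all_analysis.
From mathcomp Require Import measurable_realfun ring lra.

(* For a natural number D put f_D(w) = D w + T(w) on [0,1].  The functional equation
   of T gives the tree structure
     f_D(w/2) = f_{D+1}(w) / 2,   f_D((1+w)/2) = (D + 1 + f_{D-1}(w)) / 2,
   and 0 <= f_D <= D + 2^{-D}.  Hence the images of the two halves of [0,1] overlap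
   only in an interval of length 2^{-(D+1)}/2, and a value c in [0,D) which meets no
   such overlap at any level of the tree has exactly one preimage.  The measure of the
   values which do meet one is at most 1 - 2^{-D} < D.  As T(x) = 2^{-k}(k + f_{k-2}(w))
   for x = 2^{-k}(1+w), this produces a positive measure of y in I_k with a single
   solution x < 1/2 of T(x) = y, whence two in [0,1] by symmetry.  Finally
   T((1+w)/4) = 1/2 + T(w)/4, and f_2 <= 2 + 1/4 shows that for y > 1/4 the level
   1/2 + y/4 is not reached on [0,1/4], so that |L(1/2 + y/4)| = 2 |L(y)|.  Iterating
   y -> 1/2 + y/4 from I_3 gives (iii), and (ii) is (i) combined with (iii).
   For the possibly non-measurable sets S_n, only monotonicity of the outer measure and
   the affine invariance of null sets are used. *)

Set Implicit Arguments.
Unset Strict Implicit.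
Unset Printing Implicit Defensive.

Import Order.TTheory GRing.Theory Num.Theory.
Import numFieldNormedType.Exports.

Local Open Scope classical_set_scope.
Local Open Scope ring_scope.
Local Open Scope card_scope.

(** * Distance to the nearest integer *)

Section DistInt.
Context {R : realType}.
Implicit Types (x y : R) (z : int).

Lemma dist_int_le x z : dist_int x <= `|x - z%:~R|.
Proof. by apply: ge_inf; [exists 0 => _ [k _ <-] | exists z]. Qed.

Lemma dist_int_ge x (a : R) : (forall z, a <= `|x - z%:~R|) -> a <= dist_int x.
Proof.
move=> ax; apply: lb_le_inf; first by exists `|x - 0%:~R|, 0.
by move=> _ [z _ <-].
Qed.

Lemma dist_int_ge0 x : 0 <= dist_int x.
Proof. exact: dist_int_ge. Qed.

Lemma dist_intDz x z : dist_int (x + z%:~R) = dist_int x.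
Proof.
apply/eqP; rewrite eq_le; apply/andP; split; apply: dist_int_ge => k.
  have := dist_int_le (x + z%:~R) (k + z).
  by rewrite intrD opprD addrACA subrr addr0.
have := dist_int_le x (k - z).
by rewrite intrB opprB addrCA addrA [z%:~R + _]addrC.
Qed.

Lemma dist_intN x : dist_int (- x) = dist_int x.
Proof.
have le y : dist_int (- y) <= dist_int y.
  apply: dist_int_ge => k; have := dist_int_le (- y) (- k).
  by rewrite mulrNz -opprD normrN.
by apply/eqP; rewrite eq_le le -{1}[x]opprK le.
Qed.

Lemma dist_int_lipschitz x y : dist_int x <= `|x - y| + dist_int y.
Proof.
rewrite -lerBlDl; apply: dist_int_ge => k.
rewrite lerBlDl (le_trans (dist_int_le x k))//.
by rewrite (le_trans _ (ler_normD _ _))// addrA subrK.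
Qed.

Lemma dist_int_small x : 0 <= x <= 2^-1 -> dist_int x = x.
Proof.
move=> x01; apply/eqP; rewrite eq_le; apply/andP; split.
  by rewrite (le_trans (dist_int_le x 0))// subr0 ger0_norm//; lra.
apply: dist_int_ge => z; have [z0|z1] := leP z 0.
  have : z%:~R <= 0 :> R by rewrite lerz0.
  by move=> ?; rewrite ger0_norm; lra.
have : 1 <= z%:~R :> R by rewrite ler1z.
by move=> ?; rewrite ler0_norm; lra.
Qed.

Lemma dist_int_le_half x : dist_int x <= 2^-1.
Proof.
rewrite -(dist_intDz x (- Num.floor x)) mulrNz.
have := floor_itv x; rewrite intrD.
set f := (Num.floor x)%:~R; set y := x - f => xf.
have [yh|yh] := leP y 2^-1; first by rewrite dist_int_small; rewrite /y in yh *; lra.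
by rewrite -dist_intN -(dist_intDz _ 1) dist_int_small; rewrite /y in yh *; lra.
Qed.

Lemma dist_int_big x : 2^-1 <= x <= 1 -> dist_int x = 1 - x.
Proof.
by move=> x01; rewrite -dist_intN -(dist_intDz _ 1) dist_int_small; lra.
Qed.

End DistInt.

(** * The Takagi function: functional equation, symmetry, continuity *)

Section Takagi.
Context {R : realType}.
Implicit Types (x y w : R).

Let u x := fun n : nat => 2 ^- n * dist_int (2 ^+ n * x).

Let half_lt1 : `|2^-1 : R| < 1.
Proof. rewrite ger0_norm; lra. Qed.

Let u_ge0 x n : 0 <= u x n.
Proof. by rewrite mulr_ge0 ?dist_int_ge0// invr_ge0 exprn_ge0. Qed.

Let u_le x n : u x n <= geometric 2^-1 2^-1 n.
Proof.
rewrite /u /geometric /= mulrC exprVn.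
by rewrite ler_wpM2r ?dist_int_le_half// invr_ge0 exprn_ge0.
Qed.

Let cvg_u x : cvgn (series (u x)).
Proof.
apply: (@series_le_cvg _ _ (geometric 2^-1 2^-1)) => //.
- by move=> n; rewrite mulr_ge0 ?exprn_ge0 ?invr_ge0.
- exact: is_cvg_geometric_series.
Qed.

Lemma takagi_ge0 x : 0 <= takagi x.
Proof.
apply: limr_ge; first exact: (@cvg_u).
by apply: nearW => n; apply: sumr_ge0 => i _; exact: u_ge0.
Qed.

Lemma takagi_le1 x : takagi x <= 1.
Proof.
have := lim_series_le (@cvg_u x) (is_cvg_geometric_series (a := 2^-1) half_lt1) (u_le x).
rewrite (cvg_lim _ (cvg_geometric_series half_lt1))// => /le_trans; apply.
have -> : 1 - 2^-1 = 2^-1 :> R by lra.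
by rewrite divff// invr_eq0.
Qed.

Lemma takagiE x : takagi x = dist_int x + takagi (2 * x) / 2.
Proof.
have /cvg_unique : (fun n => series (u x) n.+1) @ \oo --> takagi x.
  by rewrite (@cvg_shiftS _ (series (u x))); exact: (@cvg_u).
apply => //; have -> : (fun n => series (u x) n.+1) =
    (fun n => dist_int x + series (u (2 * x)) n / 2).
  apply/funext => n; rewrite /series /= big_nat_recl//; congr (_ + _).
    by rewrite /u expr0 invr1 !mul1r.
  rewrite mulr_suml; apply: eq_bigr => i _.
  by rewrite /u /= exprSr invfM -!mulrA; congr (_ * _); rewrite mulrC.
by apply: cvgD; [exact: cvg_cst|apply: cvgM; [exact: (@cvg_u)|exact: cvg_cst]].
Qed.

Lemma takagiD1 x : takagi (x + 1) = takagi x.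
Proof.
congr (limn (series _)); apply/funext => n; congr (_ * _).
by rewrite mulrDr mulr1 -[RHS](dist_intDz _ (2 ^ n)%N) -pmulrn natrX.
Qed.

Lemma takagiN x : takagi (- x) = takagi x.
Proof.
by congr (limn (series _)); apply/funext => n; congr (_ * _); rewrite mulrN dist_intN.
Qed.

Lemma takagi1B w : takagi (1 - w) = takagi w.
Proof. by rewrite addrC takagiD1 takagiN. Qed.

Lemma takagi_half w : 0 <= w <= 1 -> takagi (w / 2) = w / 2 + takagi w / 2.
Proof.
move=> w01; rewrite takagiE dist_int_small; last by lra.
by congr (_ + takagi _ / 2); lra.
Qed.

Lemma takagi_half_add w : 0 <= w <= 1 ->
  takagi ((1 + w) / 2) = (1 - w) / 2 + takagi w / 2.
Proof.
move=> w01; rewrite takagiE dist_int_big; last by lra.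
by rewrite (_ : 2 * _ = w + 1) ?takagiD1; lra.
Qed.

Lemma takagi0 : takagi (0 : R) = 0.
Proof.
have h01 : 0 <= (0 : R) <= 1 by lra.
by have := takagi_half h01; rewrite mul0r; lra.
Qed.

Lemma takagi1 : takagi (1 : R) = 0.
Proof. by rewrite -takagi1B subrr takagi0. Qed.

Lemma takagi_inv2 : takagi (2^-1 : R) = 2^-1.
Proof.
have h01 : 0 <= (1 : R) <= 1 by lra.
by have := takagi_half h01; rewrite takagi1 mul1r mul0r addr0.
Qed.

(** Each use of [takagiE] costs one [|x - y|], since [dist_int] is 1-Lipschitz and the doubling of
    the argument cancels the factor 1/2, while the crude bound 1 on the remainder is halved. *)
Lemma takagi_modulus n x y :
  `|takagi x - takagi y| <= n%:R * `|x - y| + 2 ^- n.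
Proof.
elim: n x y => [|n IH] x y.
  rewrite mul0r add0r expr0 invr1.
  have := takagi_ge0 x; have := takagi_le1 x.
  have := takagi_ge0 y; have := takagi_le1 y; rewrite ler_norml; lra.
have := IH (2 * x) (2 * y).
rewrite (takagiE x) (takagiE y) -mulrBr normrM [`|2|]ger0_norm// mulrCA.
have -> : n.+1%:R * `|x - y| = n%:R * `|x - y| + `|x - y|.
  by rewrite -natr1 mulrDl mul1r.
have := dist_int_lipschitz x y; have := dist_int_lipschitz y x.
by rewrite exprS invfM [`|y - x|]distrC !ler_norml; lra.
Qed.

Lemma takagi_continuous : continuous (@takagi R).
Proof.
move=> x; apply/cvgrPdist_le => e e0.
have e20 : 0 < e / 2 by rewrite divr_gt0.
have [n /ltW ne] : exists n, 2 ^- n < e / 2.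
  have /cvgrPdist_lt /(_ _ e20) [n _ /(_ n (leqnn n))] := cvg_expr half_lt1.
  by rewrite /= sub0r normrN exprVn ger0_norm ?invr_ge0 ?exprn_ge0//; exists n.
(* Dividing by [n.+1] rather than [n] keeps the radius meaningful when [n = 0]. *)
have d0 : 0 < e / 2 / n.+1%:R by rewrite !divr_gt0.
near=> y.
have xy : `|x - y| <= e / 2 / n.+1%:R.
  by near: y; apply: cvgr_dist_le.
apply: (le_trans (takagi_modulus n x y)).
rewrite [leRHS](splitr e) lerD//.
apply: (@le_trans _ _ (n.+1%:R * `|x - y|)).
  by rewrite ler_wpM2r// ler_nat.
by rewrite mulrC -ler_pdivlMr.
Unshelve. all: by end_near. Qed.

End Takagi.

(* Keeps conversion from unfolding limits of partial sums. *)
Opaque takagi.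

(** * Tilted Takagi functions and uniqueness of preimages *)

Section TiltedTakagi.
Context {R : realType}.
Implicit Types (x y w c : R) (D n : nat).

(** This is T on [[0, 2 ^- D]] with both axes stretched by [2 ^+ D], as [takagi_scale] shows. *)
Definition tilted D w : R := D%:R * w + takagi w.

Lemma takagi_le_tilt D w : 0 <= w <= 1 -> takagi w <= D%:R * w + 2 ^- D.
Proof.
elim: D w => [|D IH] w w01.
  by rewrite mul0r add0r expr0 invr1 takagi_le1.
have [w2|w2] := leP w 2^-1.
  have w201 : 0 <= 2 * w <= 1 by lra.
  have := IH _ w201; rewrite mulrCA -[D.+1%:R]natr1 exprS invfM.
  rewrite [in takagi w](_ : w = (2 * w) / 2); last by lra.
  by rewrite takagi_half//; lra.
apply: (le_trans (takagi_le1 w)).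
case: D {IH} => [|D]; first by rewrite expr1; lra.
(* For slope at least 2 and [w > 1/2] the linear term alone exceeds 1. *)
apply: (@le_trans _ _ (2 * w)); first by lra.
have : 2 * w <= D.+2%:R * w by rewrite ler_wpM2r ?ler_nat//; lra.
have : 0 <= 2 ^- D.+2 :> R by rewrite invr_ge0 exprn_ge0.
by lra.
Qed.

Lemma tilted_half D w : 0 <= w <= 1 -> tilted D (w / 2) = tilted D.+1 w / 2.
Proof. by move=> w01; rewrite /tilted takagi_half// -[D.+1%:R]natr1; lra. Qed.

Lemma tilted_half_add D w : 0 <= w <= 1 ->
  tilted D.+1 ((1 + w) / 2) = (D.+2%:R + tilted D w) / 2.
Proof.
by move=> w01; rewrite /tilted takagi_half_add// -[D.+2%:R]natr1 -[D.+1%:R]natr1; lra.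
Qed.

Lemma tilted_ge0 D w : 0 <= w -> 0 <= tilted D w.
Proof. by move=> w0; rewrite addr_ge0 ?mulr_ge0 ?takagi_ge0. Qed.

Lemma tilted_le D w : 0 <= w <= 1 -> tilted D w <= D%:R + 2 ^- D.
(* The symmetry of T turns the bound with slope [D] at 0 into one with slope [-D] at 1, which
   cancels the tilt. *)
Proof.
move=> w01; rewrite /tilted -takagi1B.
have : takagi (1 - w) <= D%:R * (1 - w) + 2 ^- D by apply: takagi_le_tilt; lra.
by rewrite mulrBr mulr1; lra.
Qed.

Lemma takagi_scale k w : 0 <= w <= 1 -> takagi (w / 2 ^+ k) = tilted k w / 2 ^+ k.
Proof.
move=> w01; elim: k => [|k IH].
  by rewrite expr0 !divr1 /tilted mul0r add0r.
have p1 : 1 <= 2 ^+ k :> R by rewrite exprn_ege1// ler1n.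
rewrite exprSr invfM mulrA takagi_half; last first.
  have p0 : 0 < 2 ^+ k :> R by lra.
  by rewrite divr_ge0//= ?ler_pdivrMr//; lra.
by rewrite IH /tilted -[k.+1%:R]natr1; lra.
Qed.

Lemma tilted_continuous D : continuous (tilted D).
Proof.
move=> x; apply: cvgD; last exact: takagi_continuous.
by apply: cvgM; [exact: cvg_cst|exact: cvg_id].
Qed.

(* The interval is where the images of the two halves of [[0, 1]] under [tilted D] may
   overlap; away from it the first binary digit of a preimage is determined, and the two
   preimages under affine maps propagate this to the following [n - 1] digits. *)
Fixpoint bad_values n D : set R :=
  match n, D with
  | n'.+1, D'.+1 =>
    ((fun c => 2 * c + 0) @^-1` bad_values n' D'.+2 `|`
     (fun c => 2 * c + - D'.+2%:R) @^-1` bad_values n' D') `|`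
     `[D'.+2%:R / 2, D'.+2%:R / 2 + 2 ^- D'.+2 / 2]
  | _, _ => set0
  end.

Lemma tilted_near_inj n D c w w' :
  0 <= c < D%:R -> (forall k, ~ bad_values k D c) ->
  0 <= w <= 1 -> 0 <= w' <= 1 -> tilted D w = c -> tilted D w' = c ->
  `|w - w'| <= 2 ^- n.
Proof.
elim: n D c w w' => [|n IH] [|D] c w w' /andP[c0 cD] good w01 w'01 fw fw'.
- by rewrite expr0 invr1 ler_norml; lra.
- by rewrite expr0 invr1 ler_norml; lra.
- by move: cD; rewrite ltNge c0.
have left v : 0 <= v <= 1 -> v <= 2^-1 -> tilted D.+1 v = tilted D.+2 (2 * v) / 2.
  by move=> v01 v2; rewrite -tilted_half; [congr tilted; lra|lra].
have right v : 0 <= v <= 1 -> 2^-1 <= v ->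
    tilted D.+1 v = (D.+2%:R + tilted D (2 * v - 1)) / 2.
  by move=> v01 v2; rewrite -tilted_half_add; [congr tilted; lra|lra].
have half (a b : R) : `|2 * a - 2 * b| <= 2 ^- n -> `|a - b| <= 2 ^- n.+1.
  by rewrite -mulrBr normrM [`|2|]ger0_norm// exprS invfM; lra.
(* The right half only takes values at least [D.+2 / 2], so a smaller [c] forces the first digit 0.
   In either branch the rescaled value again lies in the range required by the induction
   hypothesis. *)
have [cm|cm] := ltP c (D.+2%:R / 2).
  have small v : 0 <= v <= 1 -> tilted D.+1 v = c -> v <= 2^-1.
    move=> v01 fv; rewrite leNgt; apply/negP => /ltW v2.
    have : 0 <= tilted D (2 * v - 1) by apply: tilted_ge0; lra.
    by move: fv; rewrite (right v)//; lra.
  have w2 := small w w01 fw; have w'2 := small w' w'01 fw'.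
  apply/half/(IH D.+2 (2 * c)).
  - by apply/andP; split; lra.
  - by move=> k bk; apply: (good k.+1); left; left; rewrite /preimage/= addr0.
  - by lra.
  - by lra.
  - by move: fw; rewrite (left w)//; lra.
  - by move: fw'; rewrite (left w')//; lra.
(* Goodness at depth 1 already excludes the overlap, so [c] exceeds every value of the left half. *)
have cm2 : D.+2%:R / 2 + 2 ^- D.+2 / 2 < c.
  rewrite ltNge; apply/negP => cle; apply: (good 1%N); right.
  by rewrite /= in_itv/= cm cle.
have large v : 0 <= v <= 1 -> tilted D.+1 v = c -> 2^-1 <= v.
  move=> v01 fv; rewrite leNgt; apply/negP => /ltW v2.
  have : tilted D.+2 (2 * v) <= D.+2%:R + 2 ^- D.+2 by apply: tilted_le; lra.
  by move: fv; rewrite (left v)//; lra.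
have w2 := large w w01 fw; have w'2 := large w' w'01 fw'.
rewrite (_ : w - w' = (w - 2^-1) - (w' - 2^-1)); last by lra.
apply: half; rewrite !mulrBr divff//.
apply: (IH D (2 * c + - D.+2%:R)).
- by move: cm cD; rewrite -[D.+2%:R]natr1 -[D.+1%:R]natr1 => ? ?; apply/andP; split; lra.
- by move=> k bk; apply: (good k.+1); left; right.
- by lra.
- by lra.
- by move: fw; rewrite (right w)//; lra.
- by move: fw'; rewrite (right w')//; lra.
Qed.

Lemma tilted_unique D c w w' :
  0 <= c < D%:R -> (forall k, ~ bad_values k D c) ->
  0 <= w <= 1 -> 0 <= w' <= 1 -> tilted D w = c -> tilted D w' = c -> w = w'.
Proof.
move=> cD good w01 w'01 fw fw'; apply/eqP; rewrite -subr_eq0 -normr_le0.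
have h n : `|w - w'| <= 2^-1 ^+ n.
  by rewrite exprVn; apply: (tilted_near_inj n cD).
have half_lt1 : `|2^-1 : R| < 1 by rewrite ger0_norm; lra.
have := cvg_expr half_lt1 => cv; rewrite -(cvg_lim (@Rhausdorff R) cv).
by apply: limr_ge; [exact: cvgP cv|exact: nearW].
Qed.

Lemma tilted_surj D c : 0 <= c <= D%:R -> exists2 w, 0 <= w <= 1 & tilted D w = c.
Proof.
move=> cD.
have [|||w w01 <-] := @IVT R (tilted D) 0 1 c.
- exact: ler01.
- exact/continuous_subspaceT/tilted_continuous.
- by rewrite /tilted takagi0 takagi1 mulr0 addr0 mulr1 addr0 min_l ?max_r.
- by exists w.
Qed.

End TiltedTakagi.

(** * Lebesgue measure under affine maps *)

Lemma measurable_affine (R : realType) (r a : R) (A : set R) : measurable A ->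
  measurable ((fun x => r * x + a) @^-1` A : set R).
Proof.
move=> mA; rewrite -[_ @^-1` _]setTI.
have : measurable_fun [set: R] (fun x => r * x + a : measurableTypeR R).
  by apply: measurable_funD => //; exact: mulrl_measurable.
by apply.
Qed.

(** The pushforward scaled by [r] gives each half-open interval its length, so it is Lebesgue
    measure by uniqueness. *)
Lemma lebesgue_measure_affine (R : realType) (r a : R) (A : set R) :
  0 < r -> measurable A ->
  lebesgue_measure ((fun x => r * x + a) @^-1` A) = (r^-1%:E * lebesgue_measure A)%E.
Proof.
move=> r0 mA; pose affine : R -> measurableTypeR R := fun x => r * x + a.
have maff : measurable_fun [set: R] affine.
  by move=> _ B mB; rewrite setTI; exact: measurable_affine.
rewrite (@lebesgue_measure_unique _
  (mscale (NngNum (ltW r0)) (pushforward lebesgue_measure affine)) _ A)//=.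
  by rewrite /mscale/= muleA -EFinM mulVf ?gt_eqF// mul1e.
move=> _ [[b c] _ <-].
rewrite /mscale /pushforward /=.
rewrite [X in (_ * lebesgue_measure X)%E](_ : _ = `](b - a) / r, (c - a) / r]%classic).
  rewrite !lebesgue_measure_itv/= !lte_fin ltr_pM2r ?invr_gt0// ltrD2r.
  case: ifPn => _; last by rewrite mule0.
  rewrite -!EFinD -EFinM; congr EFin.
  by field; rewrite gt_eqF.
apply/seteqP; split=> x; rewrite /affine/= !in_itv/=.
  by rewrite ltr_pdivrMr// ler_pdivlMr// mulrC; lra.
by rewrite ltr_pdivrMr// ler_pdivlMr// mulrC; lra.
Qed.

(** * Measure of the bad and good values *)

Section BadValues.
Context {R : realType}.
Notation mu := (@lebesgue_measure R).
Implicit Types (D n : nat).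

Lemma measurable_bad_values n D : measurable (@bad_values R n D).
Proof.
elim: n D => [|n IH] [|D] //=.
by apply: measurableU; [apply: measurableU; exact: measurable_affine|].
Qed.

Lemma bad_valuesS n D : @bad_values R n D `<=` bad_values n.+1 D.
Proof.
elim: n D => [|n IH] [|D] c //= [[]|].
- by move=> /IH; left; left.
- by move=> /IH; left; right.
- by right.
Qed.

(** Holds for arbitrary sets, because [lebesgue_measure] is computed by an outer measure defined on
    all of them. *)
Lemma le_lebesgue_measure (A B : set R) : A `<=` B -> (mu A <= mu B)%E.
Proof. exact: (@le_outer_measure _ _ (wlength idfun)^*%mu). Qed.

Lemma lebesgue_measureU (A B : set R) : (mu (A `|` B) <= mu A + mu B)%E.
Proof. exact: (outer_measureU2 (wlength idfun)^*%mu). Qed.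

(* The bound [1 - 2 ^- D] solves [h D = (h D.+1 + h D.-1 + 2 ^- D.+1) / 2] with [h 0 = 0]. *)
Lemma lebesgue_measure_bad_values n D :
  (mu (bad_values n D) <= (1 - 2 ^- D)%:E)%E.
Proof.
have h0 E : (0 <= (1 - 2 ^- E : R)%:E)%E.
  by rewrite lee_fin subr_ge0 invf_le1 ?exprn_gt0// exprn_ege1// ler1n.
elim: n D => [|n IH] [|D] /=; rewrite ?measure0//.
set A := _ @^-1` _; set B := _ @^-1` _; set I := [set` _].
apply: (le_trans (lebesgue_measureU _ _)).
apply: (le_trans (leeD2r _ (lebesgue_measureU _ _))).
have -> : mu I = (2 ^- D.+2 / 2)%:E.
  rewrite lebesgue_measure_itv/= lte_fin ltrDl divr_gt0 ?invr_gt0 ?exprn_gt0//.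
  by rewrite -EFinD addrAC subrr add0r.
have Ale : (mu A <= (2^-1 * (1 - 2 ^- D.+2))%:E)%E.
  rewrite lebesgue_measure_affine//; last exact: measurable_bad_values.
  by rewrite EFinM lee_pmul2l// lte_fin invr_gt0.
have Ble : (mu B <= (2^-1 * (1 - 2 ^- D))%:E)%E.
  rewrite lebesgue_measure_affine//; last exact: measurable_bad_values.
  by rewrite EFinM lee_pmul2l// lte_fin invr_gt0.
apply: (le_trans (leeD2r _ (leeD Ale Ble))).
by rewrite -!EFinD lee_fin !exprS !invfM; lra.
Qed.

(** The sets grow with the depth, so a bound uniform in the depth survives by continuity from
    below. *)
Lemma lebesgue_measure_bigcup_bad_values D :
  (mu (\bigcup_n bad_values n D) <= (1 - 2 ^- D)%:E)%E.
Proof.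
have mbad n := measurable_bad_values n D.
have cv : mu (bad_values n D) @[n --> \oo] --> mu (\bigcup_n bad_values n D).
  apply: nondecreasing_cvg_mu => //; first exact: bigcupT_measurable.
  apply/nondecreasing_seqP => n; apply/subsetPset; exact: bad_valuesS.
rewrite -(cvg_lim _ cv)//; apply: lime_le; first exact: cvgP cv.
by apply: nearW => n; exact: lebesgue_measure_bad_values.
Qed.

(** The interval has length [D - 2 ^- D.+2], which exceeds the bound [1 - 2 ^- D] on the bad set.
    The cutoff [2 ^- D.+2] serves later to rule out solutions of [T(x) = y] with
    [x <= 2 ^- D.+2]. *)
Lemma good_values_gt0 D : (0 < D)%N ->
  (0 < mu (`]2 ^- D.+2, D%:R[ `\` \bigcup_n bad_values n D))%E.
Proof.
move=> D0; set I := [set` _]; set B := \bigcup_n _.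
rewrite lt0e measure_ge0 andbT; apply/eqP => IB0.
have p0 : 0 < 2 ^- D.+2 :> R by rewrite invr_gt0 exprn_gt0.
have D1 : 1 <= D%:R :> R by rewrite ler1n.
have DD : 2 ^- D = 4 * 2 ^- D.+2 :> R by rewrite !exprS !invfM; lra.
have p1 : 2 ^- D <= 1 :> R by rewrite invf_le1 ?exprn_gt0// exprn_ege1// ler1n.
have : (mu I <= mu (I `\` B) + mu B)%E.
  apply: le_trans (lebesgue_measureU _ _); apply: le_lebesgue_measure.
  by move=> x Ix; have [|] := pselect (B x); [right|left].
rewrite IB0 add0e => /le_trans/(_ (lebesgue_measure_bigcup_bad_values D)).
rewrite lebesgue_measure_itv/= lte_fin.
by rewrite ifT ?lee_fin; lra.
Qed.

End BadValues.

(** * Cardinality of level sets *)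

Section LevelSets.
Context {R : realType}.
Notation mu := (@lebesgue_measure R).
Implicit Types (x y w : R) (k m n : nat).

Lemma takagi_quarter_add w : 0 <= w <= 1 ->
  takagi ((1 + w) / 4) = 2^-1 + takagi w / 4.
Proof.
move=> w01; rewrite (_ : (1 + w) / 4 = (1 + w) / 2 / 2); last by lra.
by rewrite takagi_half ?takagi_half_add//; lra.
Qed.

Lemma takagi_middle x : 4^-1 <= x <= 2^-1 ->
  takagi x = 2^-1 + takagi (4 * x - 1) / 4.
Proof.
move=> xq; rewrite -takagi_quarter_add; last by lra.
by congr takagi; lra.
Qed.

Lemma takagi_pt_le_half k : takagi_pt R k.+1 <= 2^-1.
Proof.
rewrite /takagi_pt ler_pdivrMr ?exprn_gt0// exprS mulKf//.
by rewrite -natrX ler_nat ltn_expl.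
Qed.

(** Below 1/4, [T(x) = x + T(2x)/2] carries the bound from one dyadic scale to the next; above 1/4,
    T is at least 1/2, which dominates every [takagi_pt]. *)
Lemma takagi_pt_le_takagi k x : 2 ^- k.+1 <= x <= 2^-1 ->
  takagi_pt R k.+1 <= takagi x.
Proof.
elim: k x => [|k IH] x xk.
  have -> : x = 1 / 2 by move: xk; rewrite expr1; lra.
  by rewrite div1r takagi_inv2 /takagi_pt expr1 div1r.
have [x4|x4] := leP x 4^-1; last first.
  apply: (le_trans (takagi_pt_le_half _)); rewrite takagi_middle; last by lra.
  by have := takagi_ge0 (4 * x - 1); lra.
have x0 : 0 <= x by apply: le_trans (andP xk).1; rewrite invr_ge0 exprn_ge0.
have x2 : 2 ^- k.+1 <= 2 * x <= 2^-1.
  by move: xk; rewrite [2 ^+ k.+2]exprS invfM; lra.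
have w01 : 0 <= 2 * x <= 1 by lra.
have := takagi_half w01; rewrite [2 * x / 2](_ : _ = x); last by lra.
move: (IH _ x2) xk; rewrite /takagi_pt -[k.+2%:R]natr1 [2 ^+ k.+2]exprS invfM.
by rewrite mulrDl mul1r mulrCA; lra.
Qed.

(** The reflection [x -> 1 - x] preserves T and swaps the two halves of [[0, 1]]; its fixed point
    1/2 is off the level by hypothesis. *)
Lemma card_level_set_double n y : y != takagi 2^-1 ->
  level_set y `&` [set x | x < 2^-1] #= `I_n -> level_set y #= `I_(n + n).
Proof.
move=> y2; rewrite card_eq_sym => /card_set_bijP[f [fL finj fsurj]].
rewrite card_eq_sym; apply/card_set_bijP.
have fP i : (i < n)%N -> [/\ 0 <= f i < 2^-1 & takagi (f i) = y].
  move=> /fL[[]] /=; rewrite in_itv/= => /andP[f0 _] fy f2.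
  by rewrite f0 f2.
exists (fun i => if (i < n)%N then f i else 1 - f (i - n)%N); split.
- move=> i /= ilt; rewrite /level_set/= in_itv/=; case: ifPn => [/fP[]|].
    by move=> ? ?; split => //; lra.
  rewrite -leqNgt => ni; have /fP[? fy] : (i - n < n)%N by rewrite ltn_subLR.
  by rewrite takagi1B; split => //; lra.
- move=> i j; rewrite !inE /= => ilt jlt.
  have sub l : (l < n + n)%N -> (n <= l)%N -> (l - n < n)%N.
    by move=> ? ?; rewrite ltn_subLR.
  case: ltnP => ni; case: ltnP => nj.
  + by apply: finj; rewrite inE.
  + by move=> e; exfalso; have [+ _] := fP _ ni; have [+ _] := fP _ (sub _ jlt nj); lra.
  + by move=> e; exfalso; have [+ _] := fP _ nj; have [+ _] := fP _ (sub _ ilt ni); lra.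
  + move=> /(congr1 (fun z => 1 - z)); rewrite !subKr => fij.
    have ij : (i - n = j - n)%N.
      by apply: finj fij; rewrite inE; apply: sub.
    by rewrite -(subnK ni) -(subnK nj) ij.
- move=> x [/=]; rewrite in_itv/= => x01 xy.
  have [x2|x2|x2] := ltgtP x 2^-1.
  + have [i ilt fi] : (f @` `I_n) x by apply: fsurj; split => //; rewrite /= in_itv.
    by exists i; rewrite /= ?ilt//; apply: ltn_addr.
  + have [i ilt fi] : (f @` `I_n) (1 - x).
      apply: fsurj; split; last by rewrite /=; lra.
      by rewrite /level_set/= in_itv/= takagi1B; split => //; lra.
    exists (n + i)%N; first by rewrite /= ltn_add2l.
    by rewrite ltnNge leq_addr/= addKn fi subKr.
  + by move: y2; rewrite -xy x2 eqxx.
Qed.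

(** The number [c] is an affine coordinate on [takagi_itv R D.+2], sending its endpoints to 0 and
    [D]. Solutions below 1/2 are located by comparing [x] with [2 ^- D.+2] and its double. *)
Lemma level_card_takagi_itv D y : (0 < D)%N ->
  let c := 2 ^+ D.+2 * y - D.+2%:R in
  2 ^- D.+2 < c < D%:R -> (forall n, ~ bad_values n D c) ->
  level_card R 2 y /\ takagi_itv R D.+2 y.
Proof.
move=> D0 c cD good.
have p0 : 0 < 2 ^+ D.+2 :> R by rewrite exprn_gt0.
have q0 : 0 < 2 ^- D.+2 :> R by rewrite invr_gt0.
have yE : y = (D.+2%:R + c) / 2 ^+ D.+2.
  by rewrite /c addrC subrK mulrC mulKf// gt_eqF.
have y_ge : takagi_pt R D.+2 <= y.
  by rewrite yE /takagi_pt ler_pM2r//; lra.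
have y_lt : y < takagi_pt R D.+1.
  rewrite yE /takagi_pt [2 ^+ D.+2]exprS invfM mulrA ltr_pM2r ?invr_gt0 ?exprn_gt0//.
  by rewrite -[D.+2%:R]natr1 -[D.+1%:R]natr1; lra.
have y_half : y < 2^-1 by apply: lt_le_trans (takagi_pt_le_half D).
have y0 : 0 <= y by apply: le_trans y_ge; rewrite divr_ge0// exprn_ge0.
split; last by rewrite /takagi_itv /= in_itv/= y_ge y_lt.
split; first by rewrite in_itv/=; lra.
have c_itv : 0 <= c < D%:R by lra.
have [w w01 fw] : exists2 w, 0 <= w <= 1 & tilted D w = c by apply: tilted_surj; lra.
have block (v : R) : 0 <= v <= 1 ->
    takagi ((1 + v) / 2 ^+ D.+2) = (D.+2%:R + tilted D v) / 2 ^+ D.+2.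
  move=> v01; rewrite [2 ^+ D.+2]exprS invfM !mulrA.
  by rewrite takagi_scale ?tilted_half_add//; lra.
have q4 : 2 * 2 ^- D.+2 <= 4^-1 :> R.
  rewrite exprS invfM mulrA divff// mul1r.
  case: D D0 {c cD good p0 q0 yE y_ge y_lt y_half c_itv w w01 fw block} => // D _.
  rewrite (_ : 4^-1 = (2 ^+ 2)^-1); last by lra.
  by rewrite lef_pV2 ?posrE ?exprn_gt0// ler_eXn2l ?ltr1n.
apply: (@card_level_set_double 1); first by rewrite takagi_inv2 lt_eqF.
rewrite (_ : _ `&` _ = [set (1 + w) / 2 ^+ D.+2]); first exact: card_set1.
apply/seteqP; split => x /=; last first.
  move=> ->; have : (1 + w) * 2 ^- D.+2 <= 2 * 2 ^- D.+2 by rewrite ler_pM2r//; lra.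
  have : 0 <= (1 + w) * 2 ^- D.+2 by rewrite mulr_ge0//; lra.
  by rewrite /level_set/= in_itv/= block// fw -yE; split; [split; lra|lra].
rewrite /level_set/= in_itv/= => -[[x01 xy] x2].
(* Here T is at most [(D.+2 + 2 ^- D.+2) / 2 ^+ D.+2], below [y] because [c > 2 ^- D.+2]. *)
have [xs|xs] := leP x (2 ^- D.+2).
  have v01 : 0 <= x * 2 ^+ D.+2 <= 1.
    by rewrite mulr_ge0 ?(ltW p0)//=; [rewrite -ler_pdivlMr// div1r|lra].
  have := takagi_scale D.+2 v01; rewrite mulfK ?gt_eqF// xy => yv.
  have : tilted D.+2 (x * 2 ^+ D.+2) = D.+2%:R + c.
    by rewrite /c addrC subrK yv [RHS]mulrC mulfVK// gt_eqF.
  by have := tilted_le D.+2 v01; lra.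
(* Beyond the block, T is at least [takagi_pt R D.+1], hence above [y]. *)
have [xl|xl] := leP x (2 * 2 ^- D.+2); last first.
  have : takagi_pt R D.+1 <= takagi x.
    apply: takagi_pt_le_takagi.
    by rewrite (ltW x2) andbT; move: xl; rewrite exprS invfM mulrA divff// mul1r => /ltW.
  by rewrite xy leNgt y_lt.
(* Inside the block, [x] corresponds to a preimage of [c] under [tilted D], unique since [c] is
   good. *)
have xp1 : 1 <= x * 2 ^+ D.+2 by rewrite -ler_pdivrMr// div1r ltW.
have xp2 : x * 2 ^+ D.+2 <= 2 by rewrite -ler_pdivlMr.
have v01 : 0 <= x * 2 ^+ D.+2 - 1 <= 1 by lra.
have xE : x = (1 + (x * 2 ^+ D.+2 - 1)) / 2 ^+ D.+2.
  by rewrite addrC subrK mulfK// gt_eqF.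
have := block _ v01; rewrite -xE xy => yv; rewrite xE.
congr ((1 + _) / _); apply: (tilted_unique c_itv good) => //.
by rewrite /c yv [_ * (_ / _)]mulrC mulfVK ?gt_eqF// addrAC subrr add0r.
Qed.

Lemma level_card_half_add n y : 4^-1 < y -> level_card R n y ->
  level_card R (n + n) (2^-1 + y / 4).
Proof.
move=> y4 [y23 yn]; split; first by move: y23; rewrite !in_itv/=; lra.
apply: card_level_set_double; first by rewrite takagi_inv2 gt_eqF//; lra.
rewrite (_ : _ `&` _ = (fun w => (1 + w) / 4) @` level_set y).
  by apply: card_eq_trans yn; apply: inj_card_eq => v w _ _ vw; lra.
apply/seteqP; split => x /=; last first.
  move=> [w []]; rewrite /= in_itv/= => w01 wy <-.
  (* Excluding [w = 1] makes [(1 + w) / 4] strictly less than 1/2. *)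
  have : w != 1 by apply/eqP => w1; move: wy; rewrite w1 takagi1; lra.
  rewrite neq_lt => /orP w1; rewrite /level_set/= in_itv/= takagi_quarter_add ?wy//.
  by case: w1 => w1; split; [split; lra| lra |split; lra| lra].
rewrite /level_set/= in_itv/= => -[[x01 xy] x2].
(* On [[0, 1/4]], T is at most [(2 + 1/4) / 4], which is below [1/2 + y/4] as [y > 1/4]. *)
have [x4|x4] := leP x 4^-1.
  have v01 : 0 <= 4 * x <= 1 by lra.
  have := takagi_scale 2 v01; have := tilted_le 2 v01.
  rewrite (_ : 2 ^+ 2 = 4); last by lra.
  rewrite [4 * x / 4](_ : _ = x) ?xy; last by lra.
  by lra.
exists (4 * x - 1); last by lra.
have := takagi_middle (x := x); rewrite xy /= in_itv/= => h.
by split; [lra|have := h; lra].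
Qed.

(** As [A] may be non-measurable, the scaling formula is applied to a measurable null cover of the
    preimage, pulled back by the inverse map. *)
Lemma lebesgue_measure_affine_gt0 (r a : R) (A : set R) : 0 < r ->
  (0 < mu A)%E -> (0 < mu ((fun x => r * x + a)%R @^-1` A))%E.
Proof.
move=> r0; rewrite !lt0e !measure_ge0 !andbT; apply: contraNN => /eqP B0.
have [N [mN N0 BN]] : mu.-negligible ((fun x => r * x + a)%R @^-1` A).
  exact/negligible_outer_measure.
apply/eqP/negligible_outer_measure.
exists ((fun x => r^-1 * x + - (r^-1 * a)) @^-1` N); split.
- exact: measurable_affine.
- by rewrite lebesgue_measure_affine ?invr_gt0// N0 mule0.
- move=> x Ax; apply: BN => /=.
  by rewrite -mulrBr mulVKf ?gt_eqF// subrK.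
Qed.

End LevelSets.

Theorem proposition5p4 (R : realType) :
  (forall k : nat, (3 <= k)%N ->
     (0 < lebesgue_measure (level_card R 2 `&` takagi_itv R k))%E) /\
  (forall m : nat, (1 <= m)%N ->
     (0 < lebesgue_measure (level_card R (2 ^ m)))%E) /\
  (forall n : nat, (1 <= n)%N ->
     (0 < lebesgue_measure (level_card R n `&` takagi_itv R 3))%E ->
     forall m : nat, (1 <= m)%N ->
     (0 < lebesgue_measure (level_card R (2 ^ m * n)))%E).
Proof.
have two k : (3 <= k)%N ->
    (0 < lebesgue_measure (level_card R 2 `&` takagi_itv R k))%E.
  case: k => [|[|D]]// D0.
  have p0 : 0 < 2 ^+ D.+2 :> R by rewrite exprn_gt0.
  apply: (lt_le_trans (lebesgue_measure_affine_gt0 (- D.+2%:R) p0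
    (good_values_gt0 D0))).
  apply: le_lebesgue_measure => y [] /=; rewrite in_itv/= => cD good.
  by apply: level_card_takagi_itv => // n bn; apply: good; exists n.
(* The condition [y > 1/4] is carried through the induction: it holds on [[3/8, 1/2)] and is
   preserved by [y -> 1/2 + y/4]. *)
have double n m : (0 < lebesgue_measure (level_card R n `&` takagi_itv R 3))%E ->
    (0 < lebesgue_measure (level_card R (2 ^ m * n) `&` [set y | 4^-1 < y]%R))%E.
  move=> n0; elim: m => [|m IH].
    apply: (lt_le_trans n0); apply: le_lebesgue_measure => y [yn].
    rewrite /takagi_itv /takagi_pt /= in_itv/= mul1n => y3; split => //=.
    by move: y3; rewrite !exprS expr0; lra.
  have four : (0 : R) < 4 by [].
  apply: (lt_le_trans (lebesgue_measure_affine_gt0 (- 2) four IH)).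
  apply: le_lebesgue_measure => y [] /= yl y4; split => /=; last by lra.
  have -> : y = 2^-1 + (4 * y - 2) / 4 by lra.
  by rewrite expnS mul2n -addnn mulnDl; exact: level_card_half_add.
have three n m : (0 < lebesgue_measure (level_card R n `&` takagi_itv R 3))%E ->
    (0 < lebesgue_measure (level_card R (2 ^ m * n)))%E.
  move=> /(double _ m) /lt_le_trans; apply.
  by apply: le_lebesgue_measure => y [].
split=> //; split=> [[//|m] _|n _ n0 m _]; last exact: three.
(* Claim (ii) uses [2 ^ m.+1 = 2 ^ m * 2] and claim (i) at [k = 3]; [three] also covers [m = 0]. *)
by rewrite expnSr; apply: three; exact: two.
Qed.
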